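(* $N$-affine equivariant additive numerical integrators and P-affine equivariant partitioned numerical integrators are closed under differentiation.
   Context: For a Banach space $Y$, $\mathfrak{X}(Y)$ denotes vector fields on $Y$, viewed as maps $Y\to Y$. Regularity is left implicit: vector fields, and the dependence of the integrator maps on their data, are taken regular enough that all derivatives written make sense. For affine $A\colon Y\to U$ with linear part $A'$, vector fields $f\in\mathfrak{X}(Y)$, $g\in\mathfrak{X}(U)$ are $A$-related if $A'\circ f=g\circ A$. Fix $N$. Additive: an additive numerical integrator is a collection of maps $\Phi=\{\Phi_{f^{[1]},\dots,f^{[N]}}\colon Y\to Y\mid f^{[1]},\dots,f^{[N]}\in\mathfrak{X}(Y),\ Y\text{ a Banach space}\}$ (application with unit time step to $f=f^{[1]}+\cdots+f^{[N]}$). It is $N$-affine equivariant if $A\circ\Phi_{f^{[1]},\dots,f^{[N]}}=\Phi_{g^{[1]},\dots,g^{[N]}}\circ A$ whenever $f^{[\nu]}$ and $g^{[\nu]}$ are $A$-related for all $\nu$, for all affine $A\colon Y\to U$ and all Banach spaces $Y,U$. It is closed under differentiation if, for all such $f^{[\nu]}$, applying $\Phi$ to the variational system $\dot y=f(y)$, $\dot\eta=f'(y)\eta$ on $Y\times Y$, decomposed by $(y,\eta)\mapsto\bigl(f^{[\nu]}(y),(f^{[\nu]})'(y)\eta\bigr)$, $\nu=1,\dots,N$, sends $(y_0,\eta_0)$ to $\bigl(\Phi_{f^{[1]},\dots,f^{[N]}}(y_0),\Phi_{f^{[1]},\dots,f^{[N]}}'(y_0)\eta_0\bigr)$. Partitioned: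 a partitioned Banach space is $Y=\bigoplus_{\nu=1}^NY^{[\nu]}$; $f\in\mathfrak{X}(Y)$ decomposes uniquely as $f=\sum_\nu f^{[\nu]}$ with $f^{[\nu]}(y)\in Y^{[\nu]}$. A partitioned numerical integrator is a collection of maps $\Phi=\{\Phi_f\colon Y\to Y\mid f\in\mathfrak{X}(Y),\ Y\text{ a partitioned Banach space}\}$. A map $A\colon Y\to U$ is P-affine if $A=\bigoplus_\nu A^{[\nu]}$ with $A^{[\nu]}\colon Y^{[\nu]}\to U^{[\nu]}$ affine; $\Phi$ is P-affine equivariant if $A\circ\Phi_f=\Phi_g\circ A$ whenever $f^{[\nu]}$ and $g^{[\nu]}$ are $A$-related for all $\nu$, for all P-affine $A$, all partitionings and all Banach spaces $Y,U$. It is closed under differentiation if, for all $f$, applying $\Phi$ to the variational system $\dot y=f(y)$, $\dot\eta=f'(y)\eta$ on $Y\times Y$, partitioned as $\bigoplus_{\nu=1}^N(Y^{[\nu]}\times Y^{[\nu]})$, sends $(y_0,\eta_0)$ to $\bigl(\Phi_f(y_0),\Phi_f'(y_0)\eta_0\bigr)$. *)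

(* Defs.v *)
From HB Require Import structures.
From mathcomp Require Import all_boot all_order all_algebra.
From mathcomp Require Import boolp classical_sets functions reals.
From mathcomp Require Import topology normedtype derive.

Set Implicit Arguments.
Unset Strict Implicit.
Unset Printing Implicit Defensive.

Import Order.TTheory GRing.Theory Num.Theory.
Import numFieldNormedType.Exports.

Local Open Scope classical_set_scope.
Local Open Scope ring_scope.

(* MathComp-Analysis puts the max norm on [Y * U] but does not provide the
   completeness of the product. *)
Section ProductComplete.
Variables (R : realType) (Y U : completeNormedModType R).

HB.instance Definition _ := Pointed.on (Y * U)%type.

Lemma prod_cauchy_cvg (F : set_system (Y * U)) :
  ProperFilter F -> cauchy F -> cvg F.
Proof.
move=> FF /cauchy_ballP Fc.
have cY : cauchy (fst @ F).
  apply/cauchy_ballP => e e0; have := Fc e e0; rewrite !near_simpl /=.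
  case=> -[P Q] /= [FP FQ] sub.
  exists (fst @` P, fst @` Q) => /=.
    by split; [apply: filterS FP | apply: filterS FQ] => p Pp; exists p.
  move=> [_ _] /= [[p Pp <-] [q Qq <-]].
  by have [] := sub (p, q) (conj Pp Qq).
have cU : cauchy (snd @ F).
  apply/cauchy_ballP => e e0; have := Fc e e0; rewrite !near_simpl /=.
  case=> -[P Q] /= [FP FQ] sub.
  exists (snd @` P, snd @` Q) => /=.
    by split; [apply: filterS FP | apply: filterS FQ] => p Pp; exists p.
  move=> [_ _] /= [[p Pp <-] [q Qq <-]].
  by have [] := sub (p, q) (conj Pp Qq).
have [a Fa] := (cvg_ex _).1 (cauchy_cvg _ cY).
have [b Fb] := (cvg_ex _).1 (cauchy_cvg _ cU).
apply/cvg_ex; exists (a, b) => S [[P Q] /= [nP nQ] sub].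
have FP : F (fst @^-1` P) by exact: Fa.
have FQ : F (snd @^-1` Q) by exact: Fb.
by apply: filterS (filterI FP FQ) => -[x y] [Px Qy]; exact: sub.
Qed.

HB.instance Definition _ :=
  Uniform_isComplete.Build (Y * U)%type prod_cauchy_cvg.

End ProductComplete.

Section Smooth.
Variable R : realType.

(* (y, eta) |-> f'(y) eta *)
Definition dmap (E F : normedModType R) (f : E -> F) : E * E -> F :=
  fun p => 'd f (p.1) (p.2).

(* Class C^k in the sense of Michal and Bastiani: continuity of the iterated
   differentials is required jointly in the base point and the directions,
   rather than for the operator norm.  For a fixed k this is weaker than the
   operator norm version of C^k, but it implies the operator norm version of
   C^(k-1); so both give the same notion of smoothness. *)
Fixpoint Ck (k : nat) (E F : normedModType R) (f : E -> F) : Prop :=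
  if k is k'.+1 then (forall x, differentiable f x) /\ Ck k' (dmap f)
  else continuous f.

Definition smooth (E F : normedModType R) (f : E -> F) : Prop :=
  forall k, Ck k f.

(* The vector field (f(y), f'(y) eta) of the variational system on Y * Y. *)
Definition variational (Y : normedModType R) (f : Y -> Y) : Y * Y -> Y * Y :=
  fun p => (f p.1, 'd f (p.1) (p.2)).

Definition linear_part (Y U : normedModType R) (A : Y -> U) : Y -> U :=
  fun y => A y - A 0.

Definition affine (Y U : normedModType R) (A : Y -> U) : Prop :=
  linear (linear_part A) /\ continuous A.

Definition related (Y U : normedModType R) (A : Y -> U)
    (f : Y -> Y) (g : U -> U) : Prop :=
  linear_part A \o f = g \o A.

End Smooth.

(* X(Y) is the set of smooth maps Y -> Y.  Integrators are total on all maps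
   Y -> Y, but only their values on X(Y) are ever used or constrained. *)

Section Additive.
Variables (R : realType) (N : nat).

Definition additive_integrator :=
  forall Y : completeNormedModType R, ('I_N -> Y -> Y) -> Y -> Y.

Implicit Type Phi : additive_integrator.

(* The implicit regularity of Phi: differentiability in the initial value,
   and continuity along smooth one-parameter families of vector fields. *)
Definition additive_regular Phi : Prop :=
  (forall (Y : completeNormedModType R) (f : 'I_N -> Y -> Y),
     (forall nu, smooth (f nu)) ->
     forall y, differentiable (Phi Y f) y) /\
  (forall (Y : completeNormedModType R) (f : R -> 'I_N -> Y -> Y),
     (forall nu, smooth (fun p : R * Y => f p.1 nu p.2)) ->
     forall y, continuous (fun e : R => Phi Y (f e) y)).

Definition N_affine_equivariant Phi : Prop :=
  forall (Y U : completeNormedModType R) (A : Y -> U)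
         (f : 'I_N -> Y -> Y) (g : 'I_N -> U -> U),
    affine A ->
    (forall nu, smooth (f nu)) -> (forall nu, smooth (g nu)) ->
    (forall nu, related A (f nu) (g nu)) ->
    A \o Phi Y f = Phi U g \o A.

Definition additive_closed_under_differentiation Phi : Prop :=
  forall (Y : completeNormedModType R) (f : 'I_N -> Y -> Y),
    (forall nu, smooth (f nu)) ->
    forall y0 eta0 : Y,
      Phi (Y * Y)%type (fun nu => variational (f nu)) (y0, eta0)
      = (Phi Y f y0, 'd (Phi Y f) y0 eta0).

End Additive.

Section Partitioned.
Variables (R : realType) (N : nat).

(* A Banach space presented as the topological direct sum of the Banach spaces
   [part nu], with injections [inj nu] and projections [proj nu]. *)
Record partitionedBanach := PartitionedBanach {
  carrier :> completeNormedModType R;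
  part : 'I_N -> completeNormedModType R;
  inj : forall nu, {linear part nu -> carrier};
  proj : forall nu, {linear carrier -> part nu};
  inj_continuous : forall nu, continuous (inj nu);
  proj_continuous : forall nu, continuous (proj nu);
  injK : forall nu x, proj nu (inj nu x) = x;
  proj_inj0 : forall nu mu x, nu != mu -> proj nu (inj mu x) = 0;
  sum_inj_proj : forall y, \sum_(nu < N) inj nu (proj nu y) = y
}.

Arguments inj {_} nu.
Arguments proj {_} nu.
Arguments inj_continuous {_} nu.
Arguments proj_continuous {_} nu.

(* f^[nu] : Y -> Y^[nu], the latter viewed as a subspace of Y *)
Definition component (Y : partitionedBanach) (f : Y -> Y) (nu : 'I_N) :
    Y -> Y :=
  fun y => inj nu (proj nu (f y)).

Definition P_affine (Y U : partitionedBanach) (A : Y -> U) : Prop :=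
  exists Anu : forall nu : 'I_N, part Y nu -> part U nu,
    (forall nu, affine (Anu nu)) /\
    (forall y, A y = \sum_(nu < N) inj nu (Anu nu (proj nu y))).

(* Y * Y partitioned as the direct sum of the Y^[nu] * Y^[nu] *)
Section Double.
Variable Y : partitionedBanach.

Definition double_inj (nu : 'I_N) (p : part Y nu * part Y nu) : Y * Y :=
  (inj nu p.1, inj nu p.2).

Definition double_proj (nu : 'I_N) (p : Y * Y) : part Y nu * part Y nu :=
  (proj nu p.1, proj nu p.2).

Lemma double_inj_linear nu : linear (@double_inj nu).
Proof. by move=> a [x1 x2] [y1 y2]; congr pair; rewrite /= linearP. Qed.

Lemma double_proj_linear nu : linear (double_proj nu).
Proof. by move=> a [x1 x2] [y1 y2]; congr pair; rewrite /= linearP. Qed.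

HB.instance Definition _ nu := GRing.isLinear.Build R
  (part Y nu * part Y nu)%type (Y * Y)%type _ (@double_inj nu)
  (@double_inj_linear nu).
HB.instance Definition _ nu := GRing.isLinear.Build R
  (Y * Y)%type (part Y nu * part Y nu)%type _ (double_proj nu)
  (@double_proj_linear nu).

Lemma double_inj_continuous nu : continuous (@double_inj nu).
Proof.
move=> p; apply: cvg_pair; apply: continuous_comp;
  by [exact: cvg_fst | exact: cvg_snd | exact: inj_continuous].
Qed.

Lemma double_proj_continuous nu : continuous (double_proj nu).
Proof.
move=> p; apply: cvg_pair; apply: continuous_comp;
  by [exact: cvg_fst | exact: cvg_snd | exact: proj_continuous].
Qed.

Lemma double_injK nu p : double_proj nu (@double_inj nu p) = p.
Proof. by case: p => x y; rewrite /double_proj /= !injK. Qed.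

Lemma double_proj_inj0 nu mu p :
  nu != mu -> double_proj nu (@double_inj mu p) = 0.
Proof. by move=> ne; rewrite /double_proj /= !proj_inj0. Qed.

Lemma double_sum_inj_proj p :
  \sum_(nu < N) double_inj (double_proj nu p) = p.
Proof.
rewrite [LHS]surjective_pairing [RHS]surjective_pairing.
congr pair.
  rewrite (raddf_sum (@fst Y Y)) /=; exact: sum_inj_proj.
rewrite (raddf_sum (@snd Y Y)) /=; exact: sum_inj_proj.
Qed.

Definition double_space : partitionedBanach :=
  @PartitionedBanach (Y * Y)%type (fun nu => (part Y nu * part Y nu)%type)
    (fun nu => @double_inj nu) (fun nu => double_proj nu)
    double_inj_continuous double_proj_continuous
    double_injK double_proj_inj0 double_sum_inj_proj.

End Double.

Definition partitioned_integrator :=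
  forall Y : partitionedBanach, (Y -> Y) -> Y -> Y.

Implicit Type Phi : partitioned_integrator.

Definition partitioned_regular Phi : Prop :=
  (forall (Y : partitionedBanach) (f : Y -> Y),
     smooth f -> forall y, differentiable (Phi Y f) y) /\
  (forall (Y : partitionedBanach) (f : R -> Y -> Y),
     smooth (fun p : R * Y => f p.1 p.2) ->
     forall y, continuous (fun e : R => Phi Y (f e) y)).

Definition P_affine_equivariant Phi : Prop :=
  forall (Y U : partitionedBanach) (A : Y -> U) (f : Y -> Y) (g : U -> U),
    P_affine A -> smooth f -> smooth g ->
    (forall nu, related A (component f nu) (component g nu)) ->
    A \o Phi Y f = Phi U g \o A.

Definition partitioned_closed_under_differentiation Phi : Prop :=
  forall (Y : partitionedBanach) (f : Y -> Y),
    smooth f ->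
    forall y0 eta0 : Y,
      Phi (double_space Y) (variational f) (y0, eta0)
      = (Phi Y f y0, 'd (Phi Y f) y0 eta0).

End Partitioned.

Arguments double_space {R N} Y.

(* Main.v *)
Require Import Defs.
From HB Require Import structures.
From mathcomp Require Import all_boot all_order all_algebra.
From mathcomp Require Import ring lra.
From mathcomp Require Import boolp classical_sets functions reals.
From mathcomp Require Import topology prodnormedzmodule normedtype landau.
From mathcomp Require Import sequences derive.

(**
The field f on Y is related, by the projection (y, eta) |-> y and by the shear
(y, eta) |-> y + e eta, to the field
  g_e (y, eta) = (f y, (f (y + e eta) - f y) / e)
on Y * Y.  Both maps are affine (and P-affine for the partition of Y * Y), so
equivariance forces
  Phi_(g_e) (y, eta) = (Phi_f y, (Phi_f (y + e eta) - Phi_f y) / e).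
As e tends to 0, g_e tends to the variational field and the right-hand side to
(Phi_f y, Phi_f' y eta).  Continuity of Phi in e applies because g_e extends
smoothly to e = 0: by Hadamard's lemma, (f (y + e eta) - f y) / e is the mean
of f' (y + s e eta) eta over s in [0, 1].  For smooth f, the mean J f (x, h) of
f (x + s h) over s in [0, 1] is the limit of dyadic Riemann sums, and its
differential is again such a mean,
  (J f)' (x, h) (v, w) = J (dmap f) ((x, v), (h, w)),
whence J f is smooth by induction on the order of differentiation.
*)

Set Implicit Arguments.
Unset Strict Implicit.
Unset Printing Implicit Defensive.

Import Order.TTheory GRing.Theory Num.Theory.
Import numFieldNormedType.Exports.

Local Open Scope classical_set_scope.
Local Open Scope ring_scope.

(** * Smooth maps *)

Section SmoothCalculus.
Variable R : realType.

Lemma Ck_continuous k (E F : normedModType R) (f : E -> F) :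
  Ck k f -> continuous f.
Proof. by case: k => [|k] //= [df _] x; exact: differentiable_continuous. Qed.

Lemma CkS k (E F : normedModType R) (f : E -> F) : Ck k.+1 f -> Ck k f.
Proof.
elim: k E F f => [|k IHk] E F f fC; first exact: (@Ck_continuous 1).
by case: fC => df /IHk.
Qed.

Lemma smooth_differentiable (E F : normedModType R) (f : E -> F) x :
  smooth f -> differentiable f x.
Proof. by move=> /(_ 1) [df _]. Qed.

Lemma smooth_continuous (E F : normedModType R) (f : E -> F) :
  smooth f -> continuous f.
Proof. by move=> /(_ 0). Qed.

Lemma smooth_dmap (E F : normedModType R) (f : E -> F) :
  smooth f -> smooth (dmap f).
Proof. by move=> fs k; have [] := fs k.+1. Qed.

Lemma smooth_linear (E F : normedModType R) (f : E -> F) :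
  linear f -> continuous f -> smooth f.
Proof.
move=> + + k; elim: k E F f => [|k IHk] E F f flin fc //.
pose fL : {linear E -> F} := HB.pack f (GRing.isLinear.Build _ _ _ _ _ flin).
split=> [x|]; first exact: (@linear_differentiable _ _ _ fL).
have -> : dmap f = f \o snd.
  by apply/funext => p; rewrite /dmap (@diff_lin _ _ _ fL).
apply: IHk => [a u v|p]; first exact: flin.
by apply: continuous_comp; [exact: cvg_snd|exact: fc].
Qed.

Lemma smooth_fst (E F : normedModType R) : smooth (@fst E F).
Proof. by apply: smooth_linear => // p; exact: cvg_fst. Qed.

Lemma smooth_snd (E F : normedModType R) : smooth (@snd E F).
Proof. by apply: smooth_linear => // p; exact: cvg_snd. Qed.

Lemma smooth_id (E : normedModType R) : smooth (@id E).
Proof. by apply: smooth_linear => // x; exact: cvg_id. Qed.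

Lemma smooth_cst (E F : normedModType R) (a : F) : smooth (cst a : E -> F).
Proof.
case=> [|k]; first exact: cst_continuous.
split=> [x|]; first exact: differentiable_cst.
have -> : dmap (cst a : E -> F) = cst 0.
  by apply/funext => p; rewrite /dmap diff_cst.
apply: smooth_linear => [r u v|]; first by rewrite scaler0 addr0.
exact: cst_continuous.
Qed.

Lemma Ck_pair k (E F G : normedModType R) (f : E -> F) (g : E -> G) :
  Ck k f -> Ck k g -> Ck k (fun x => (f x, g x)).
Proof.
elim: k E F G f g => [|k IHk] E F G f g.
  by move=> fc gc x; apply: cvg_pair; [exact: fc|exact: gc].
move=> [df fk] [dg gk]; split=> [x|]; first exact: differentiable_pair.
have -> : dmap (fun x => (f x, g x)) = (fun p => (dmap f p, dmap g p)).
  by apply/funext => p; rewrite /dmap diff_pair.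
exact: IHk.
Qed.

(** By the chain rule [dmap (g \o f)] is [dmap g] after [(f \o fst, dmap f)]. At order [k] this
    needs [f] as well as [dmap f], hence the appeal to [CkS]. *)
Lemma Ck_comp k (E F G : normedModType R) (f : E -> F) (g : F -> G) :
  Ck k f -> Ck k g -> Ck k (g \o f).
Proof.
elim: k E F G f g => [|k IHk] E F G f g.
  by move=> fc gc x; apply: continuous_comp; [exact: fc|exact: gc].
move=> /[dup] /CkS fk' [df fk] [dg gk].
split=> [x|]; first exact: differentiable_comp.
have -> : dmap (g \o f) = dmap g \o (fun p => ((f \o fst) p, dmap f p)).
  by apply/funext => p; rewrite /dmap diff_comp.
by apply: (IHk _ _ _ _ _ _ gk); apply: Ck_pair fk; apply: IHk fk';
  exact: smooth_fst.
Qed.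

Lemma smooth_pair (E F G : normedModType R) (f : E -> F) (g : E -> G) :
  smooth f -> smooth g -> smooth (fun x => (f x, g x)).
Proof. by move=> fs gs k; exact: Ck_pair. Qed.

Lemma smooth_comp (E F G : normedModType R) (f : E -> F) (g : F -> G) :
  smooth f -> smooth g -> smooth (g \o f).
Proof. by move=> fs gs k; exact: Ck_comp. Qed.

Lemma smooth_add (E : normedModType R) : smooth (fun p : E * E => p.1 + p.2).
Proof.
apply: smooth_linear => [a u v /=|p]; first by rewrite scalerDr addrACA.
by apply: cvgD; [exact: cvg_fst|exact: cvg_snd].
Qed.

Lemma scale_bilinear (E : normedModType R) :
  bilinear_for (GRing.Scale.Law.clone _ _ *:%R _)
    (GRing.Scale.Law.clone _ _ *:%R _) (@GRing.scale R E).
Proof.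
split=> [u|u] a x y /=; first by rewrite scalerDl scalerA.
by rewrite scalerDr !scalerA mulrC.
Qed.

(** The product rule writes the differential as a sum of two scalings precomposed with linear maps,
    so the induction on the order closes. *)
Lemma smooth_scale (E : normedModType R) : smooth (fun p : R * E => p.1 *: p.2).
Proof.
pose s : {bilinear R -> E -> E} := HB.pack (@GRing.scale R E)
  (bilinear_isBilinear.Build R R E E _ _ _ (@scale_bilinear E)).
have sc : continuous (fun p : R * E => s p.1 p.2).
  by move=> p; apply: cvgZ; [exact: cvg_fst|exact: cvg_snd].
elim=> [|k IHk]; first exact: sc.
split=> [x|]; first exact: (differentiable_bilin (f := s)).
have -> : dmap (fun p : R * E => p.1 *: p.2) = (fun p : E * E => p.1 + p.2) \o
    (fun p => (((fun p : R * E => p.1 *: p.2) \o (fun q => (q.1.1, q.2.2))) p,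
               ((fun p : R * E => p.1 *: p.2) \o (fun q => (q.2.1, q.1.2))) p)).
  by apply/funext => p; rewrite /dmap (diff_bilin (f := s)).
apply: Ck_comp; last exact: smooth_add.
by apply: Ck_pair; apply: (Ck_comp _ IHk); apply: smooth_pair;
  apply: smooth_comp; (exact: smooth_fst || exact: smooth_snd).
Qed.

End SmoothCalculus.

(** * Dyadic means of curves *)

Section MeanValue.
Variable R : realType.

Lemma differentiable_near (E F : normedModType R) (f : E -> F) x (e : R) :
  differentiable f x -> 0 < e ->
  \forall h \near 0, `|f (x + h) - f x - 'd f x h| <= e * `|h|.
Proof.
move=> /diff_locally/eqaddoP df e0; have := df e e0.
by apply: filterS => h /=; rewrite !fctE /= (addrC h) opprD addrA.
Qed.

Lemma diff_near_unique (E F : normedModType R) (f df : E -> F) x :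
  linear df -> continuous df ->
  (forall e : R, 0 < e ->
     \forall h \near 0, `|f (x + h) - f x - df h| <= e * `|h|) ->
  differentiable f x /\ 'd f x = df :> (E -> F).
Proof.
move=> dflin dfc dfe.
pose dfL : {linear E -> F} :=
  HB.pack df (GRing.isLinear.Build _ _ _ _ _ dflin).
have fE : f \o shift x = cst (f x) + dfL +o_ 0 id.
  apply/eqaddoP => e e0; have := dfe e e0.
  by apply: filterS => h /=; rewrite !fctE /= (addrC h) opprD addrA.
have dE : 'd f x = dfL :> (E -> F) by exact: diff_unique.
by split=> //; apply/diff_locallyP; rewrite dE.
Qed.

(* The minimum over [a, b] of t |-> |phi t - phi a| - (M + 2 e) (t - a) can
   only be attained at b, as this function decreases locally to the right. *)
Lemma mean_value_le (F : normedModType R) (phi : R -> F) (M a b : R) :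
  a <= b -> (forall t, differentiable phi t) ->
  (forall t, a <= t <= b -> `|'d phi t 1| <= M) ->
  `|phi b - phi a| <= M * (b - a).
Proof.
move=> ab dphi phiM.
have phic : continuous phi by move=> t; exact: differentiable_continuous.
suff main e : 0 < e -> `|phi b - phi a| <= (M + 2 * e) * (b - a).
  (* The slack becomes [e * ((b - a) / (b - a + 1))], at most [e]; the added 1 keeps the denominator
     positive when [a = b]. *)
  apply/ler_addgt0Pr => e e0; have := main (e / (2 * (b - a + 1))).
  have ba1 : 0 < b - a + 1 by lra.
  move=> /(_ _)/le_trans; apply; first by apply: divr_gt0 => //; lra.
  rewrite mulrDl lerD2l.
  have -> : 2 * (e / (2 * (b - a + 1))) * (b - a) = e * ((b - a) / (b - a + 1)).
    by field; rewrite gt_eqF//; lra.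
  by rewrite ler_piMr ?(ltW e0)// ler_pdivrMr//; lra.
move=> e0.
pose psi t := `|phi t - phi a| - (M + 2 * e) * (t - a).
have psic : continuous psi.
  move=> t; apply: cvgB; first by apply: cvg_norm; apply: cvgB;
    [exact: phic|exact: cvg_cst].
  by apply: cvgM; [exact: cvg_cst|apply: cvgB; [exact: cvg_id|exact: cvg_cst]].
have [c /[!in_itv]/= /andP[ac cb] cmin] :=
  EVT_min ab (continuous_subspaceT psic).
have [cb'|bc] := ltP c b; last first.
  have := cmin a; rewrite in_itv/= lexx ab => /(_ isT).
  have -> : c = b by apply/eqP; rewrite eq_le cb bc.
  by rewrite /psi subrr normr0 subrr mulr0 subr0 subr_le0.
have := differentiable_near (dphi c) e0.
move=> /nbhs_ballP[d /= d0 dP].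
pose h := Num.min (d / 2) (b - c).
have h0 : 0 < h by rewrite lt_min; apply/andP; split; [exact: divr_gt0|lra].
have hbc : h <= b - c by rewrite ge_min lexx orbT.
have hd : h < d by rewrite gt_min; apply/orP; left; lra.
have := dP h; rewrite /ball/= sub0r normrN (gtr0_norm h0) => /(_ hd) hle.
have chab : a <= c + h <= b by apply/andP; split; lra.
have := cmin (c + h); rewrite in_itv/= chab => /(_ isT).
rewrite leNgt => /negP[]; rewrite /psi.
have dh : `|'d phi c h| <= M * h.
  have -> : 'd phi c h = h *: 'd phi c 1 by rewrite -linearZ /= [h *: 1]mulr1.
  rewrite normrZ gtr0_norm// mulrC ler_wpM2r ?(ltW h0)//.
  by apply: phiM; rewrite ac ltW.
(* The norm grows by at most [(M + e) * h], while the term subtracted in [psi] grows by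
   [(M + 2 * e) * h]. *)
have : `|phi (c + h) - phi a| <= `|phi c - phi a| + (M + e) * h.
  have -> : phi (c + h) - phi a =
      (phi (c + h) - phi c - 'd phi c h) + 'd phi c h + (phi c - phi a).
    by rewrite subrK addrA subrK.
  apply: le_trans (ler_normD _ _) _; rewrite addrC lerD2l.
  by apply: le_trans (ler_normD _ _) _; rewrite mulrDl addrC lerD.
have : 0 < e * h by rewrite mulr_gt0.
by lra.
Qed.

(** The mean value inequality applied to [t |-> phi t - t *: v]. *)
Lemma mean_value_affine (F : normedModType R) (phi : R -> F)
    (v : F) (M a b : R) :
  a <= b -> (forall t, differentiable phi t) ->
  (forall t, a <= t <= b -> `|'d phi t 1 - v| <= M) ->
  `|phi b - phi a - (b - a) *: v| <= M * (b - a).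
Proof.
move=> ab dphi phiM.
have dv (t : R) : is_diff t ( *:%R^~ v : R -> F) ( *:%R^~ v).
  exact: is_diff_scalel.
have dpsi t : is_diff t (phi - ( *:%R^~ v)) (('d phi t : R -> F) - ( *:%R^~ v)).
  by apply: is_diffB; exact: differentiableP.
have := @mean_value_le F _ M a b ab (fun t => @ex_diff _ _ _ _ _ _ _ (dpsi t)).
have -> : phi b - phi a - (b - a) *: v =
    (phi - ( *:%R^~ v)) b - (phi - ( *:%R^~ v)) a.
  by rewrite !fctE scalerBl !opprD addrACA.
apply => t tab; rewrite diff_val !fctE scale1r; exact: phiM.
Qed.

Lemma line_diff (E F : normedModType R) (f : E -> F) x h (t : R) :
  differentiable f (x + t *: h) ->
  differentiable (fun s : R => f (x + s *: h)) t /\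
  'd (fun s : R => f (x + s *: h)) t 1 = 'd f (x + t *: h) h.
Proof.
move=> df.
have dl : is_diff t (cst x + ( *:%R^~ h)) (0 + ( *:%R^~ h)) by exact: is_diffD.
have dfl := differentiable_comp (@ex_diff _ _ _ _ _ _ _ dl) df.
split; first exact: dfl.
have /(congr1 (fun g : R -> F => g 1)) :=
  diff_comp (@ex_diff _ _ _ _ _ _ _ dl) df.
by rewrite /= diff_val => ->; rewrite /= add0r scale1r.
Qed.

End MeanValue.

(** * Dyadic Riemann sums and their limits *)

Section DyadicMean.
Variables (R : realType) (F : normedModType R).
Implicit Types (c d : R -> F) (a l K M : R).

(** The left-endpoint Riemann sum over [[a, a + l]] with [2 ^ n] equal pieces. Recursion on the two
    halves lets estimates be proved by induction on [n]. *)
Fixpoint dyadic_sum n c a l : F :=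
  if n is n'.+1 then
    dyadic_sum n' c a (l / 2) + dyadic_sum n' c (a + l / 2) (l / 2)
  else l *: c a.

Lemma dyadic_sum_linear n (k : R) c d a l :
  dyadic_sum n (fun t => k *: c t + d t) a l =
  k *: dyadic_sum n c a l + dyadic_sum n d a l.
Proof.
elim: n a l => [|n IHn] a l /=; first by rewrite scalerDr !scalerA mulrC.
by rewrite !IHn scalerDr addrACA.
Qed.

Lemma dyadic_sum_cst n v a l : dyadic_sum n (cst v) a l = l *: v.
Proof. by elim: n a l => //= n IHn a l; rewrite !IHn -scalerDl -splitr. Qed.

Lemma dyadic_sum_le n c a l M : 0 <= l ->
  (forall t, a <= t <= a + l -> `|c t| <= M) -> `|dyadic_sum n c a l| <= l * M.
Proof.
elim: n a l => [|n IHn] a l l0 cM /=.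
  by rewrite normrZ ger0_norm// ler_wpM2l// cM// lexx lerDl.
apply: le_trans (ler_normD _ _) _; rewrite [in leRHS](splitr l) mulrDl.
by apply: lerD; apply: IHn; [lra| |lra|] => t /andP[at_ tl]; apply: cM; lra.
Qed.

(** For [n = 0] the values of [c] lie within [K * l] of [c a], an error of [K * l ^+ 2] in all. Each
    halving replaces such a bound by two quarters of it. *)
Lemma dyadic_sum_cauchy n p c a l K : 0 <= K -> 0 <= l ->
  (forall s t, a <= s <= a + l -> a <= t <= a + l ->
     `|c s - c t| <= K * `|s - t|) ->
  `|dyadic_sum (n + p) c a l - dyadic_sum n c a l| <= K * l ^+ 2 / 2 ^+ n.
Proof.
move=> K0; elim: n a l => [|n IHn] a l l0 cK.
  rewrite add0n expr0 divr1.
  have aal : a <= a <= a + l by rewrite lexx lerDl.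
  (* The one-point sum [l *: c a] is also the [p]-th dyadic sum of the constant [c a], so the
     difference is a single dyadic sum. *)
  have -> : dyadic_sum p c a l - dyadic_sum 0 c a l =
      dyadic_sum p (fun t => (-1) *: cst (c a) t + c t) a l.
    by rewrite dyadic_sum_linear dyadic_sum_cst /= scaleN1r addrC.
  rewrite expr2 mulrA mulrC; apply: dyadic_sum_le => // t tal.
  rewrite scaleN1r addrC; apply: le_trans (cK _ _ tal aal) _.
  rewrite ger0_norm; last lra.
  by apply: ler_wpM2l => //; lra.
rewrite addSn /= opprD addrACA; apply: le_trans (ler_normD _ _) _.
have -> : K * l ^+ 2 / 2 ^+ n.+1 =
    K * (l / 2) ^+ 2 / 2 ^+ n + K * (l / 2) ^+ 2 / 2 ^+ n.
  by rewrite (exprS 2); field; rewrite expf_neq0 ?pnatr_eq0.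
by apply: lerD; apply: IHn; [lra| |lra|] => s t ? ?; apply: cK; lra.
Qed.

(** The increments of [C] telescope, and [2 ^ n] pieces of length [l / 2 ^ n] each contribute an
    error quadratic in their length. *)
Lemma dyadic_sum_primitive n (C c : R -> F) a l K : 0 <= l ->
  (forall s t, a <= s -> s <= t -> t <= a + l ->
     `|C t - C s - (t - s) *: c s| <= K * (t - s) ^+ 2) ->
  `|C (a + l) - C a - dyadic_sum n c a l| <= K * l ^+ 2 / 2 ^+ n.
Proof.
elim: n a l => [|n IHn] a l l0 CK /=.
  have := CK a (a + l); have -> : a + l - a = l by lra.
  by rewrite expr0 divr1; apply; lra.
have -> : C (a + l) - C a -
    (dyadic_sum n c a (l / 2) + dyadic_sum n c (a + l / 2) (l / 2)) =
  (C (a + l / 2) - C a - dyadic_sum n c a (l / 2)) +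
  (C (a + l / 2 + l / 2) - C (a + l / 2) - dyadic_sum n c (a + l / 2) (l / 2)).
  have -> : a + l / 2 + l / 2 = a + l by lra.
  rewrite [RHS]addrACA -opprD; congr (_ - _).
  by rewrite [RHS]addrC addrA subrK.
apply: le_trans (ler_normD _ _) _.
have -> : K * l ^+ 2 / 2 ^+ n.+1 =
    K * (l / 2) ^+ 2 / 2 ^+ n + K * (l / 2) ^+ 2 / 2 ^+ n.
  by rewrite (exprS 2); field; rewrite expf_neq0 ?pnatr_eq0.
by apply: lerD; apply: IHn; [lra| |lra|] => s t ? ? ?; apply: CK; lra.
Qed.

Definition is_mean (c : R -> F) (m : F) :=
  dyadic_sum n c 0 1 @[n --> \oo] --> m.

Lemma is_mean_unique c m m' : is_mean c m -> is_mean c m' -> m = m'.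
Proof. exact: cvg_unique. Qed.

Lemma is_mean_linear (k : R) c d m m' : is_mean c m -> is_mean d m' ->
  is_mean (fun t => k *: c t + d t) (k *: m + m').
Proof.
move=> cm dm; rewrite /is_mean.
under eq_fun do rewrite dyadic_sum_linear.
by apply: cvgD => //; apply: cvgZl_tmp.
Qed.

Lemma is_mean_cst v : is_mean (cst v) v.
Proof.
rewrite /is_mean; under eq_fun do rewrite dyadic_sum_cst scale1r.
exact: cvg_cst.
Qed.

Lemma is_mean_le c m M : is_mean c m ->
  (forall t, 0 <= t <= 1 -> `|c t| <= M) -> `|m| <= M.
Proof.
move=> cm cM; apply: cvgr_to_le (cvg_norm cm) _.
near=> n; rewrite -[M]mul1r; apply: dyadic_sum_le; first exact: ler01.
by move=> t; rewrite add0r; exact: cM.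
Unshelve. all: by end_near. Qed.

Lemma cvg_dyadic (K : R) : K / 2 ^+ n @[n --> \oo] --> 0.
Proof.
under eq_fun do rewrite -exprVn.
by apply: cvg_geometric; rewrite ger0_norm ?invr_ge0// invf_lt1// ltr1n.
Qed.

(** A form of the fundamental theorem of calculus, for a derivative [c] of [C] with uniform
    quadratic remainder. *)
Lemma is_mean_primitive (C c : R -> F) K :
  (forall s t, 0 <= s -> s <= t -> t <= 1 ->
     `|C t - C s - (t - s) *: c s| <= K * (t - s) ^+ 2) ->
  is_mean c (C 1 - C 0).
Proof.
move=> CK; apply/cvgrPdist_le => e e0.
have /cvgr0_norm_le /(_ e e0) := @cvg_dyadic K.
apply: filterS => n; apply: le_trans; apply: le_trans (ler_norm _).
have := @dyadic_sum_primitive n C c 0 1 K ler01.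
by rewrite add0r expr1n mulr1; apply.
Qed.

End DyadicMean.

Lemma is_mean_ex (R : realType) (F : completeNormedModType R) (c : R -> F)
    (K : R) :
  0 <= K ->
  (forall s t, 0 <= s <= 1 -> 0 <= t <= 1 -> `|c s - c t| <= K * `|s - t|) ->
  exists m, is_mean c m.
Proof.
move=> K0 cK; apply/cvg_ex; apply: cauchy_cvg.
apply: cauchy_exP => e e0.
have [n nP] : exists n, K / 2 ^+ n < e.
  have /cvgr0_norm_lt /(_ e e0) [n _ nP] := @cvg_dyadic R K.
  by exists n; apply: le_lt_trans (ler_norm _) (nP n _) => /=.
exists (dyadic_sum n c 0 1); exists n => // m /= nm.
rewrite -ball_normE /= distrC -(subnKC nm).
have := @dyadic_sum_cauchy R F n (m - n) c 0 1 K K0 ler01.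
by rewrite add0r expr1n mulr1 => /(_ cK)/le_lt_trans; exact.
Qed.

(** * Means over a segment *)

Section SegmentMean.
Variable R : realType.

(* Joint continuity of dmap f does not control the operator norm; Frechet
   differentiability of dmap f at (z, 0) does. *)
Lemma smooth_diff_near (E F : normedModType R) (f : E -> F) z (e : R) :
  smooth f -> 0 < e ->
  \forall u \near 0, forall k, `|'d f (z + u) k - 'd f z k| <= e * `|k|.
Proof.
move=> fs e0; have e30 : 0 < e / 3 by rewrite divr_gt0.
have dg := smooth_differentiable (z, 0) (smooth_dmap fs).
have /nbhs_ballP[d /= d0 dP] := differentiable_near dg e30.
pose D : {linear (E * E)%type -> F} := 'd (dmap f) (z, 0).
have dP' (u k : E) : `|u| <= d / 2 -> `|k| <= d / 2 ->
    `|'d f (z + u) k - D (u, k)| <= e / 3 * (d / 2).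
  move=> ud kd.
  have ukd : `|((u, k) : (E * E)%type : normedModType R)| <= d / 2.
    by rewrite prod_normE ge_max ud.
  have := dP (u, k); rewrite -ball_normE /= sub0r normrN => /(_ _).
  rewrite /dmap /= linear0 subr0 add0r => H.
  apply: le_trans (H _) _; first by apply: le_lt_trans ukd _; lra.
  by rewrite ler_pM2l.
apply/nbhs_ballP; exists (d / 2) => /=; first by rewrite divr_gt0.
move=> u; rewrite -ball_normE /= sub0r normrN => /ltW ud k.
have d20 : 0 <= d / 2 by lra.
have main (k' : E) : `|k'| <= d / 2 ->
    `|'d f (z + u) k' - 'd f z k'| <= e * (d / 2).
  move=> k'd; have D1 := dP' u k' ud k'd.
  have := dP' 0 k' _ k'd; rewrite normr0 addr0 => /(_ d20) D2.
  have := dP' u 0 ud; rewrite normr0 linear0 sub0r normrN => /(_ d20) D3.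
  (* Additivity of [D] isolates [D (u, 0)]. Each of the three terms is at most [e / 3 * (d / 2)],
     the middle one because ['d f (z + u)] vanishes at 0. *)
  have -> : 'd f (z + u) k' - 'd f z k' = ('d f (z + u) k' - D (u, k')) +
      D (u, 0) - ('d f z k' - D (0, k')).
    have -> : D (u, k') = D (u, 0) + D (0, k').
      rewrite -linearD; congr (D _).
      by rewrite -[RHS]/(u + 0, 0 + k') addr0 add0r.
    by rewrite opprB opprD !addrA (addrAC (_ - _)) !subrK.
  apply: le_trans (ler_normB _ _) _.
  by apply: le_trans (lerD (ler_normD _ _) (lexx _)) _; lra.
have [->|k0] := eqVneq k 0.
  by rewrite !(linear0 ('d f _)) subrr !normr0 mulr0.
have k0' : 0 < `|k| by rewrite normr_gt0.
have dk0 : 0 <= d / 2 / `|k| by rewrite divr_ge0.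
(* Homogeneity carries the bound from vectors of norm [d / 2] to every [k]. *)
have := main ((d / 2 / `|k|) *: k).
rewrite normrZ (ger0_norm dk0) divfK ?gt_eqF// lexx => /(_ isT).
have dfZ y (c : R) : 'd f y (c *: k) = c *: 'd f y k by exact: linearZ.
rewrite !dfZ -scalerBr normrZ (ger0_norm dk0).
have -> : e * (d / 2) = d / 2 / `|k| * (e * `|k|) by field; rewrite gt_eqF.
by rewrite ler_pM2l// divr_gt0// divr_gt0.
Qed.

(** The tube lemma: compactness of [[0, 1]] lets one neighbourhood of 0 serve all [s]. *)
Lemma unit_interval_near (E : normedModType R) (P : E -> R -> Prop) :
  (forall s : R, \forall t \near s & u \near (0 : E), P u t) ->
  \forall u \near (0 : E), forall s, 0 <= s <= 1 -> P u s.
Proof.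
move=> nP; have /compact_near_coveringP cov := @segment_compact R 0 1.
near=> u => s s01.
have /(_ s) : `[0, 1] `<=` P u by near: u; apply: cov => t _; exact: nP.
by apply; rewrite /= in_itv.
Unshelve. all: by end_near. Qed.

(** For [t] near [s], the differentials at [x + t *: h + u] and at [x + t *: h] are both within
    [e / 2] of the one at [x + s *: h]; compactness then makes this uniform. *)
Lemma segment_diff_near (E F : normedModType R) (f : E -> F) x h (e : R) :
  smooth f -> 0 < e ->
  \forall u \near 0, forall s, 0 <= s <= 1 ->
    forall k, `|'d f (x + s *: h + u) k - 'd f (x + s *: h) k| <= e * `|k|.
Proof.
move=> fs e0; have e20 : 0 < e / 2 by rewrite divr_gt0.
apply: (@unit_interval_near E (fun u s => forall k,
  `|'d f (x + s *: h + u) k - 'd f (x + s *: h) k| <= e * `|k|)) => s.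
have nz := smooth_diff_near (x + s *: h) fs e20.
have c1 : (fun p : R * E => (p.1 - s) *: h + p.2) @ (s, 0) --> (0 : E).
  rewrite -[X in _ --> X]addr0 -[X in _ --> X + _](scale0r h) -(subrr s).
  apply: cvgD; last exact: cvg_snd.
  by apply: cvgZr_tmp; apply: cvgB; [exact: cvg_fst|exact: cvg_cst].
have c2 : (fun p : R * E => (p.1 - s) *: h) @ (s, 0) --> (0 : E).
  rewrite -[X in _ --> X](scale0r h) -(subrr s).
  by apply: cvgZr_tmp; apply: cvgB; [exact: cvg_fst|exact: cvg_cst].
have n1 := c1 _ nz; have n2 := c2 _ nz.
have : \forall p \near nbhs (s, 0 : E), forall k,
   `|'d f (x + s *: h + ((p.1 - s) *: h + p.2)) k - 'd f (x + s *: h) k| <=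
     e / 2 * `|k| /\
   `|'d f (x + s *: h + (p.1 - s) *: h) k - 'd f (x + s *: h) k| <=
     e / 2 * `|k|.
  by near=> p => k; split; move: k; near: p; [exact: n1|exact: n2].
apply: filterS => -[t u] /= n12 k; have [{}n1 {}n2] := n12 k.
have e1 : x + t *: h = x + s *: h + (t - s) *: h.
  by rewrite scalerBl addrA addrAC addrK.
have -> : 'd f (x + t *: h + u) k - 'd f (x + t *: h) k =
   ('d f (x + s *: h + ((t - s) *: h + u)) k - 'd f (x + s *: h) k) -
   ('d f (x + s *: h + (t - s) *: h) k - 'd f (x + s *: h) k).
  by rewrite addrA -e1 opprB addrA subrK.
apply: le_trans (ler_normB _ _) _; rewrite (splitr e) mulrDl.
exact: lerD.
Unshelve. all: by end_near. Qed.

(** The mean value inequality along [t |-> f (z + t *: u)] turns closeness of the differentials into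
    a first-order remainder uniform over the segment. *)
Lemma segment_remainder_near (E F : normedModType R) (f : E -> F) x h (e : R) :
  smooth f -> 0 < e ->
  \forall u \near 0, forall s, 0 <= s <= 1 ->
    `|f (x + s *: h + u) - f (x + s *: h) - 'd f (x + s *: h) u| <= e * `|u|.
Proof.
move=> fs e0.
have /nbhs_ballP[d /= d0 dP] := segment_diff_near x h fs e0.
apply/nbhs_ballP; exists d => //= u.
rewrite -ball_normE /= sub0r normrN => ud s s01.
set z := x + s *: h.
have df t := line_diff (smooth_differentiable (z + t *: u) fs).
have := @mean_value_affine R F (fun t : R => f (z + t *: u)) ('d f z u)
  (e * `|u|) 0 1 ler01 (fun t => (df t).1).
rewrite scale1r scale0r addr0 subr0 scale1r mulr1; apply => t /andP[t0 t1].
rewrite (df t).2.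
apply: dP => //; rewrite -ball_normE /= sub0r normrN normrZ ger0_norm//.
by apply: le_lt_trans ud; rewrite ler_piMl.
Qed.

(** [K] is the maximum over [[0, 1]] of the norm of ['d f (x + t *: h) h]. Joint continuity of
    [dmap f] suffices, as the direction [h] is fixed. *)
Lemma segment_lipschitz (E F : normedModType R) (f : E -> F) x h :
  smooth f -> exists2 K : R, 0 <= K & forall s t, 0 <= s <= 1 -> 0 <= t <= 1 ->
    `|f (x + s *: h) - f (x + t *: h)| <= K * `|s - t|.
Proof.
move=> fs; pose g (t : R) := `|dmap f (x + t *: h, h)|.
have gc : continuous g.
  move=> t; apply: cvg_norm; apply: continuous_comp.
    apply: cvg_pair; last exact: cvg_cst.
    by apply: cvgD; [exact: cvg_cst|exact: scalel_continuous].
  exact: (smooth_continuous (smooth_dmap fs)).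
have [c _ cmax] := EVT_max ler01 (continuous_subspaceT gc).
exists (g c); first exact: normr_ge0.
have le s t : 0 <= s <= 1 -> 0 <= t <= 1 -> s <= t ->
    `|f (x + t *: h) - f (x + s *: h)| <= g c * (t - s).
  move=> s01 t01 st.
  apply: (mean_value_le (phi := fun t : R => f (x + t *: h))) => //.
    by move=> r; have [] := line_diff (smooth_differentiable (x + r *: h) fs).
  move=> r srt.
  have [_ ->] := line_diff (smooth_differentiable (x + r *: h) fs).
  by apply: cmax; rewrite in_itv /=; lra.
move=> s t s01 t01; have [st|/ltW ts] := leP s t.
  rewrite distrC (distrC s) (ger0_norm (_ : 0 <= t - s)) ?subr_ge0//.
  exact: le.
by rewrite (ger0_norm (_ : 0 <= s - t)) ?subr_ge0//; exact: le.
Qed.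

(** The operator [J], made total by [lim]; the sums converge for smooth [f] by [segment_meanP]. *)
Definition segment_mean (E : normedModType R) (F : completeNormedModType R)
    (f : E -> F) (p : E * E) : F :=
  lim (dyadic_sum n (fun t : R => f (p.1 + t *: p.2)) 0 1 @[n --> \oo]).

Lemma segment_meanP (E : normedModType R) (F : completeNormedModType R)
    (f : E -> F) p : smooth f ->
  is_mean (fun t : R => f (p.1 + t *: p.2)) (segment_mean f p).
Proof.
move=> fs; have [K K0 fK] := segment_lipschitz p.1 p.2 fs.
have [m mP] := is_mean_ex K0 fK.
by have /cvgP := mP.
Qed.

Lemma segment_mean0 (E : normedModType R) (F : completeNormedModType R)
    (f : E -> F) x : segment_mean f (x, 0) = f x.
Proof.
apply: cvg_lim => //; rewrite /=.
under eq_fun do under eq_fun do rewrite scaler0 addr0.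
exact: is_mean_cst.
Qed.

(** With base [(x, h)] and direction [(h, 0)], the averaged curve is ['d f (x + t *: h) h], the
    velocity of [f (x + t *: h)]. It is Lipschitz, so its mean is the increment. *)
Lemma segment_mean_primitive (E : normedModType R) (F : completeNormedModType R)
    (f : E -> F) x h : smooth f ->
  segment_mean (dmap f) ((x, h), (h, 0)) = f (x + h) - f x.
Proof.
move=> fs; have dfs := smooth_dmap fs.
have := segment_meanP (p := ((x, h), (h, 0))) dfs.
rewrite /=; move/is_mean_unique; apply.
have [K K0 fK] := segment_lipschitz (x, h) (h, 0) dfs.
have := @is_mean_primitive R F (fun t : R => f (x + t *: h))
  (fun t : R => dmap f ((x, h) + t *: (h, 0))) K.
rewrite scale1r scale0r addr0; apply => s t s0 st t1.
rewrite expr2 mulrA.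
have df r := line_diff (smooth_differentiable (x + r *: h) fs).
apply: (mean_value_affine (phi := fun t : R => f (x + t *: h))) => //
  [r|r /andP[sr rt]].
  exact: (df r).1.
have e t' : dmap f ((x, h) + t' *: (h, 0)) = 'd f (x + t' *: h) h.
  by rewrite /dmap /= scaler0 addr0.
rewrite (df r).2 -e; apply: le_trans (fK r s _ _) _; [lra|lra|].
rewrite ger0_norm ?subr_ge0//; apply: ler_wpM2l => //; lra.
Qed.

(** Replacing [p] by [p + q] displaces the point [p.1 + t *: p.2] by [q.1 + t *: q.2], which is
    small uniformly in [t] when [q] is small. *)
Lemma segment_displacement_near (E : normedModType R) (A : E -> Prop) :
  (\forall u \near (0 : E), A u) ->
  \forall q \near (0 : E * E), forall t : R, 0 <= t <= 1 -> A (q.1 + t *: q.2).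
Proof.
move=> nA; apply: (@unit_interval_near (E * E)%type
  (fun q t => A (q.1 + t *: q.2))) => s.
have c : continuous (fun p : R * (E * E) => p.2.1 + p.1 *: p.2.2).
  move=> p; apply: cvgD; last apply: cvgZ.
  - by apply: (@continuous_comp _ _ _ snd fst); [exact: cvg_snd|exact: cvg_fst].
  - exact: cvg_fst.
  - by apply: (@continuous_comp _ _ _ snd snd); exact: cvg_snd.
have := c (s, 0); rewrite /continuous_at /= scaler0 addr0 => {}c.
exact: c nA.
Qed.

(** Serves the continuity at 0 of the candidate differential of [segment_mean f]. It follows from
    joint continuity of [dmap f], which vanishes in the direction 0. *)
Lemma segment_dmap_near (E F : normedModType R) (f : E -> F) x h (e : R) :
  smooth f -> 0 < e ->
  \forall u \near 0, forall s, 0 <= s <= 1 -> `|'d f (x + s *: h) u| <= e.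
Proof.
move=> fs e0.
apply: (@unit_interval_near E (fun u s => `|'d f (x + s *: h) u| <= e)) => s.
have c : (fun p : R * E => dmap f (x + p.1 *: h, p.2)) @ (s, 0) --> (0 : F).
  have <- : dmap f (x + s *: h, 0) = 0 by rewrite /dmap /= linear0.
  apply: (continuous_comp (f := fun p : R * E => (x + p.1 *: h, p.2)));
    last first.
    exact: (smooth_continuous (smooth_dmap fs)).
  apply: cvg_pair; last exact: cvg_snd.
  by apply: cvgD; [exact: cvg_cst|apply: cvgZr_tmp; exact: cvg_fst].
exact: (cvgr0_norm_le _ c e e0).
Qed.

Lemma norm_segment_le (E : normedModType R) (q : E * E) (t : R) :
  0 <= t <= 1 ->
  `|q.1 + t *: q.2| <= 2 * `|(q : (E * E)%type : normedModType R)|.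
Proof.
move=> /andP[t0 t1]; apply: le_trans (ler_normD _ _) _.
rewrite normrZ ger0_norm// mulr2n mulrDl mul1r; apply: lerD.
  by rewrite prod_normE le_max lexx.
apply: (@le_trans _ _ `|q.2|); first by rewrite ler_piMl.
by rewrite prod_normE le_max lexx orbT.
Qed.

Lemma segment_mean_diff (E : normedModType R) (F : completeNormedModType R)
    (f : E -> F) (p : E * E) : smooth f ->
  differentiable (segment_mean f) p /\
  'd (segment_mean f) p =
    (fun q => segment_mean (dmap f) ((p.1, q.1), (p.2, q.2))) :> (E * E -> F).
Proof.
move=> fs; have dfs := smooth_dmap fs.
have dP q := segment_meanP (p := ((p.1, q.1), (p.2, q.2))) dfs.
set df := fun q => segment_mean (dmap f) ((p.1, q.1), (p.2, q.2)).
have dflin : linear df.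
  move=> a u v; apply: is_mean_unique (dP _) _.
  have := is_mean_linear (k := a) (dP u) (dP v).
  congr is_mean; apply/funext => t; rewrite /dmap /=.
  rewrite -linearP; congr ('d f _ _).
  by rewrite !scalerDr !scalerA mulrC addrACA.
have dfc : continuous df.
  pose dfL : {linear (E * E)%type -> F} :=
    HB.pack df (GRing.isLinear.Build _ _ _ _ _ dflin).
  apply: (@continuousfor0_continuous _ _ _ dfL).
  rewrite /prop_for /continuous_at (linear0 dfL).
  apply/cvgr0Pnorm_le => e e0.
  have := segment_displacement_near (segment_dmap_near p.1 p.2 fs e0).
  apply: filterS => q qP; apply: is_mean_le (dP q) _ => t t01.
  exact: qP.
apply: diff_near_unique => // e e0.
(* Half of [e] absorbs the factor 2 of [norm_segment_le]. *)
have e20 : 0 < e / 2 by rewrite divr_gt0.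
have := segment_displacement_near (segment_remainder_near p.1 p.2 fs e20).
apply: filterS => q qP.
(* The remainder of [segment_mean f] is exhibited as the mean of the pointwise remainders of [f]. *)
have M := is_mean_linear (k := -1) (segment_meanP (p := p) fs)
  (segment_meanP (p := p + q) fs).
have {M} := is_mean_linear (k := -1) (dP q) M.
rewrite !scaleN1r [- segment_mean f p + _]addrC.
rewrite [- segment_mean (dmap f) _ + _]addrC.
move/is_mean_le; apply => t t01; rewrite !scaleN1r /=.
(* The displacement and the base point are taken at the same parameter [t]. *)
have := qP t t01 t t01.
have -> : p.1 + q.1 + t *: (p.2 + q.2) = p.1 + t *: p.2 + (q.1 + t *: q.2).
  by rewrite scalerDr addrACA.
rewrite addrC [- f _ + _]addrC => /le_trans; apply.
have := norm_segment_le q t01; nra.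
Qed.

Lemma segment_mean_smooth (E : normedModType R) (F : completeNormedModType R)
    (f : E -> F) : smooth f -> smooth (segment_mean f).
Proof.
(* The domain varies in the induction, since [dmap f] lives on [E * E]. *)
move=> + k; elim: k E f => [|k IHk] E f fs.
  move=> p; apply: differentiable_continuous; exact: (segment_mean_diff p fs).1.
split=> [p|]; first exact: (segment_mean_diff p fs).1.
have -> : dmap (segment_mean f) = segment_mean (dmap f) \o
    (fun p => ((p.1.1, p.2.1), (p.1.2, p.2.2))).
  by apply/funext => p; rewrite /dmap (segment_mean_diff _ fs).2.
apply: Ck_comp; last exact/IHk/smooth_dmap.
by do 2?[apply: smooth_pair]; apply: smooth_comp;
  (exact: smooth_fst || exact: smooth_snd).
Qed.

(* Hadamard's extension of (f (y + e eta) - f y) / e to e = 0, written as the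
   mean of f'(y + s e eta) eta over s in [0, 1]. *)
Definition diff_quotient (E : normedModType R) (F : completeNormedModType R)
    (f : E -> F) (e : R) (p : E * E) : F :=
  segment_mean (dmap f) (p, (e *: p.2, 0)).

Lemma diff_quotient0 (E : normedModType R) (F : completeNormedModType R)
  (f : E -> F) p : diff_quotient f 0 p = 'd f (p.1) (p.2).
Proof. by rewrite /diff_quotient scale0r segment_mean0. Qed.

(** Stated without division, so that [e = 0] is covered; for a field it is the relation along the
    shear that equivariance asks for. *)
Lemma diff_quotientE (E : normedModType R) (F : completeNormedModType R)
    (f : E -> F) e p : smooth f ->
  f p.1 + e *: diff_quotient f e p = f (p.1 + e *: p.2).
Proof.
move=> fs; have dfs := smooth_dmap fs.
(* By linearity in the direction, [e] moves inside the mean, and [segment_mean_primitive] applies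
   with [h = e *: p.2]. *)
have <- : segment_mean (dmap f) ((p.1, e *: p.2), (e *: p.2, 0)) =
    e *: diff_quotient f e p.
  apply: is_mean_unique (segment_meanP dfs) _.
  have := is_mean_linear (k := e) (segment_meanP (p := (p, (e *: p.2, 0))) dfs)
    (@is_mean_cst R F 0).
  rewrite addr0; congr is_mean; apply/funext => t.
  rewrite /dmap /= !scaler0 !addr0; apply: esym; exact: linearZ.
by rewrite segment_mean_primitive// addrC subrK.
Qed.

Lemma diff_quotient_smooth (E : normedModType R) (F : completeNormedModType R)
    (f : E -> F) : smooth f ->
  smooth (fun p : R * (E * E) => diff_quotient f p.1 p.2).
Proof.
move=> fs.
apply: (smooth_comp (f := fun p : R * (E * E) => (p.2, (p.1 *: p.2.2, 0 : E)))
  (g := segment_mean (dmap f))); last exact/segment_mean_smooth/smooth_dmap.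
apply: smooth_pair; first exact: smooth_snd.
apply: smooth_pair; last exact: smooth_cst.
apply: (smooth_comp (f := fun p : R * (E * E) => (p.1, p.2.2))
  (g := fun p : R * E => p.1 *: p.2)); last exact: smooth_scale.
apply: smooth_pair; first exact: smooth_fst.
by apply: smooth_comp; exact: smooth_snd.
Qed.

End SegmentMean.

(** * Closure under differentiation *)

Section Perturbation.
Variable R : realType.

Lemma shear_affine (Y : normedModType R) (e : R) :
  affine (fun p : Y * Y => p.1 + e *: p.2).
Proof.
split=> [a u v|p].
  rewrite /linear_part /= scaler0 addr0 !subr0 scalerDr scalerA mulrC -scalerA.
  by rewrite addrACA -scalerDr scalerDr.
apply: cvgD; first exact: cvg_fst.
by apply: cvgZl_tmp; exact: cvg_snd.
Qed.

Lemma fst_affine (Y : normedModType R) : affine (@fst Y Y).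
Proof.
split=> [a u v|p]; last exact: cvg_fst.
by rewrite /linear_part /= !subr0.
Qed.

Definition perturbation (Y : completeNormedModType R) (f : Y -> Y) (e : R)
    (p : Y * Y) : Y * Y := (f p.1, diff_quotient f e p).

Lemma perturbation0 (Y : completeNormedModType R) (f : Y -> Y) :
  perturbation f 0 = variational f.
Proof. by apply/funext => p; rewrite /perturbation diff_quotient0. Qed.

Lemma perturbation_smooth (Y : completeNormedModType R) (f : Y -> Y) :
  smooth f -> smooth (fun p : R * (Y * Y) => perturbation f p.1 p.2).
Proof.
move=> fs; apply: smooth_pair; last exact: diff_quotient_smooth.
apply: (smooth_comp (f := fun p : R * (Y * Y) => p.2.1)) => //.
by apply: smooth_comp; [exact: smooth_snd|exact: smooth_fst].
Qed.

Lemma perturbation_slice_smooth (Y : completeNormedModType R) (f : Y -> Y) e :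
  smooth f -> smooth (perturbation f e).
Proof.
move=> fs; apply: (smooth_comp (f := fun p : Y * Y => (e, p))
  (g := fun p : R * (Y * Y) => perturbation f p.1 p.2)).
  by apply: smooth_pair; [exact: smooth_cst|exact: smooth_id].
exact: perturbation_smooth.
Qed.

(** The limit argument shared by both kinds of integrator: [Psi e] stands for the integrator applied
    to [g_e], and the last two hypotheses are what the projection and the shear yield. *)
Lemma variational_limit (Y : completeNormedModType R) (phi : Y -> Y)
    (Psi : R -> Y * Y -> Y * Y) (y0 eta0 : Y) :
  differentiable phi y0 ->
  continuous (fun e : R => Psi e (y0, eta0)) ->
  (forall e, (Psi e (y0, eta0)).1 = phi y0) ->
  (forall e, (Psi e (y0, eta0)).1 + e *: (Psi e (y0, eta0)).2 =
     phi (y0 + e *: eta0)) ->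
  Psi 0 (y0, eta0) = (phi y0, 'd phi y0 eta0).
Proof.
move=> dphi Psic Psi1 Psi2.
rewrite [LHS]surjective_pairing Psi1; congr pair.
rewrite -deriveE //; apply/esym/cvg_lim => //.
have c : (fun e : R => (Psi e (y0, eta0)).2) @ 0^' --> (Psi 0 (y0, eta0)).2.
  apply: cvg_within_filter.
  by apply: (@continuous_comp _ _ _ (fun e : R => Psi e (y0, eta0)) snd);
    [exact: Psic|exact: cvg_snd].
apply: cvg_trans c; apply: near_eq_cvg; near=> e.
have e0 : e != 0 by near: e; exact: nbhs_dnbhs_neq.
(* For [e != 0] the two identities determine the second component as the difference quotient of
   [phi]. *)
rewrite /= (addrC _ y0) -Psi2 Psi1 addrAC subrr add0r.
by rewrite scalerA mulVf// scale1r.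
Unshelve. all: by end_near. Qed.

End Perturbation.

Lemma additive_variational (R : realType) (N : nat)
    (Phi : additive_integrator R N) :
  additive_regular Phi -> N_affine_equivariant Phi ->
  additive_closed_under_differentiation Phi.
Proof.
move=> [Phid Phic] Phie Y f fs y0 eta0.
(* The variational fields are the member [e = 0] of the perturbed family. *)
have -> : (fun nu => variational (f nu)) = (fun nu => perturbation (f nu) 0).
  by apply/funext => nu; rewrite perturbation0.
have gs e nu : smooth (perturbation (f nu) e).
  by exact: perturbation_slice_smooth.
apply: (@variational_limit R Y (Phi Y f)
  (fun e => Phi (Y * Y)%type (fun nu => perturbation (f nu) e))).
- exact: Phid.
- by apply: (Phic (Y * Y)%type (fun e nu => perturbation (f nu) e)) => nu;
    exact: perturbation_smooth.
- move=> e.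
  have := Phie (Y * Y)%type Y fst (fun nu => perturbation (f nu) e) f
    (@fst_affine R Y) (gs e) fs.
  move=> /(_ _)/(congr1 (@^~ (y0, eta0))); apply => nu.
  by apply/funext => p; rewrite /linear_part /= subr0.
- move=> e.
  have := Phie (Y * Y)%type Y (fun p => p.1 + e *: p.2)
    (fun nu => perturbation (f nu) e) f (@shear_affine R Y e) (gs e) fs.
  move=> /(_ _)/(congr1 (@^~ (y0, eta0))); apply => nu.
  apply/funext => p; rewrite /linear_part /= scaler0 addr0 subr0.
  exact: diff_quotientE.
Qed.

(** A formula [A] available on every normed space also acts on each [part Y nu]; commuting with the
    projections makes these actions the blocks of [A Y]. *)
Lemma P_affine_double (R : realType) (N : nat) (Y : partitionedBanach R N)
    (A : forall V : normedModType R, V * V -> V) :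
  (forall V, affine (A V)) ->
  (forall nu p, A (part Y nu) (@double_proj R N Y nu p) =
    @proj R N Y nu (A Y p)) ->
  P_affine (Y := double_space Y) (A Y).
Proof.
move=> Aa AE; exists (fun nu => A (part Y nu)); split=> [nu|p]; first exact: Aa.
by under eq_bigr do rewrite /= AE; rewrite sum_inj_proj.
Qed.

Lemma partitioned_variational (R : realType) (N : nat)
    (Phi : partitioned_integrator R N) :
  partitioned_regular Phi -> P_affine_equivariant Phi ->
  partitioned_closed_under_differentiation Phi.
Proof.
move=> [Phid Phic] Phie Y f fs y0 eta0.
rewrite -perturbation0.
have gs e : smooth (perturbation f e) by exact: perturbation_slice_smooth.
apply: (@variational_limit R Y (Phi Y f)
  (fun e => Phi (double_space Y) (perturbation f e))).
- exact: Phid.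
- by apply: (Phic (double_space Y) (fun e => perturbation f e));
    exact: perturbation_smooth.
- move=> e.
  have A1 : P_affine (Y := double_space Y) (U := Y) fst.
    apply: (@P_affine_double R N Y (fun V => fst)) => // V; exact: fst_affine.
  have := Phie (double_space Y) Y fst (perturbation f e) f A1 (gs e) fs.
  move=> /(_ _)/(congr1 (@^~ (y0, eta0))); apply => nu.
  by apply/funext => p; rewrite /linear_part /= subr0.
- move=> e.
  have A2 : P_affine (Y := double_space Y) (U := Y) (fun p => p.1 + e *: p.2).
    apply: (@P_affine_double R N Y (fun V p => p.1 + e *: p.2)) => [V|nu p].
      exact: shear_affine.
    by rewrite /= linearD linearZ.
  have := Phie (double_space Y) Y (fun p => p.1 + e *: p.2)
    (perturbation f e) f A2 (gs e) fs.
  move=> /(_ _)/(congr1 (@^~ (y0, eta0))); apply => nu.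
  apply/funext => p; rewrite /linear_part /= scaler0 addr0 subr0.
  (* [inj nu] and [proj nu] are linear, so the shear relation passes from [f] to its components. *)
  by rewrite /component -(diff_quotientE e p fs) !linearD !linearZ.
Qed.

Theorem theorem5p20 (R : realType) (N : nat) :
  (forall Phi : additive_integrator R N,
     additive_regular Phi ->
     N_affine_equivariant Phi ->
     additive_closed_under_differentiation Phi) /\
  (forall Phi : partitioned_integrator R N,
     partitioned_regular Phi ->
     P_affine_equivariant Phi ->
     partitioned_closed_under_differentiation Phi).
Proof.
by split=> Phi; [exact: additive_variational|exact: partitioned_variational].
Qed.
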